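(* Let $u=\cdots u_{-2}u_{-1}|u_0u_1u_2\cdots$ be a bidirectional infinite word over a finite alphabet $\mathcal{A}=\{0,1,\dots,d-1\}$. Let $\Delta_0,\dots,\Delta_{d-1}$ be positive real numbers linearly independent over $\mathbb{Q}$. Set $t_0=0$. For $k\geq 1$ define $t_k=\sum_{i=0}^{d-1}|w|_i\Delta_i$, where $w=u_0u_1\cdots u_{k-1}$. For $k\leq -1$ define $t_k=-\sum_{i=0}^{d-1}|w|_i\Delta_i$, where $w=u_{k}u_{k+1}\cdots u_{-1}$. On the set $\Sigma=\{t_k\mid k\in\mathbb{Z}\}$ define a binary operation $\oplus$ by $t_j\oplus t_k=t_{j+k}$ for $j,k\in\mathbb{Z}$. Then $(\Sigma,\oplus)$ is isomorphic to $(\mathbb{Z},+)$, and $\oplus$ is compatible with addition in $\mathbb{R}$.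
   Context: $|w|_i$ denotes the number of occurrences of the letter $i$ in the finite word $w$. The operation $\oplus$ on $\Sigma\subset\mathbb{R}$ is said to be compatible with addition in $\mathbb{R}$ if for all $x,y\in\Sigma$, whenever $x+y\in\Sigma$, then $x\oplus y=x+y$. *)

(* Defs.v *)
From mathcomp Require Import all_boot all_order all_algebra.
From mathcomp Require Import boolp classical_sets reals.
Set Implicit Arguments.
Unset Strict Implicit.
Unset Printing Implicit Defensive.
Import Order.TTheory GRing.Theory Num.Theory.
Local Open Scope ring_scope.
Local Open Scope classical_set_scope.

Definition lin_indep_rat (R : realType) (d : nat) (Delta : 'I_d -> R) : Prop :=
  forall c : 'I_d -> rat,
    \sum_(i < d) ratr (c i) * Delta i = 0 -> forall i, c i = 0.

(* The factor u_a u_{a+1} ... u_{a+n-1} of a bidirectional word; the origin of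
   the pointed word is the index 0 of u : int -> A. *)
Definition factor (A : Type) (u : int -> A) (a : int) (n : nat) : seq A :=
  mkseq (fun m => u (a + m%:Z)) n.

Definition geom_length (R : realType) (d : nat) (Delta : 'I_d -> R)
    (w : seq 'I_d) : R :=
  \sum_(i < d) (count_mem i w)%:R * Delta i.

Definition tpoint (R : realType) (d : nat) (Delta : 'I_d -> R)
    (u : int -> 'I_d) (k : int) : R :=
  if 0 < k then geom_length Delta (factor u 0 `|k|%N)
  else if k < 0 then - geom_length Delta (factor u k `|k|%N)
  else 0.

Definition Sigma (R : realType) (d : nat) (Delta : 'I_d -> R)
    (u : int -> 'I_d) : set R :=
  [set x | exists k : int, x = tpoint Delta u k].

(* t_j (+) t_k = t_{j+k}, required for all indices representing the two points,
   so that such an operation exists only if the rule is well defined. *)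
Definition adds_indices (R : realType) (d : nat) (Delta : 'I_d -> R)
    (u : int -> 'I_d)
    (op : Sigma Delta u -> Sigma Delta u -> Sigma Delta u) : Prop :=
  forall (j k : int) (x y : Sigma Delta u),
    val x = tpoint Delta u j -> val y = tpoint Delta u k ->
    val (op x y) = tpoint Delta u (j + k).

Definition compatible_with_addition (R : realType) (S : set R)
    (op : S -> S -> S) : Prop :=
  forall x y : S, S (val x + val y) -> val (op x y) = val x + val y.

Definition isomorphic (A B : Type) (opA : A -> A -> A) (opB : B -> B -> B)
    : Prop :=
  exists f : A -> B, bijective f /\ {morph f : x y / opA x y >-> opB x y}.

(* Main.v *)
Require Import Defs.
From mathcomp Require Import all_boot all_order all_algebra.
From mathcomp Require Import boolp classical_sets reals.
Import Order.TTheory GRing.Theory Num.Theory.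
Local Open Scope ring_scope.
Local Open Scope classical_set_scope.

(** Write [t_k] as the combination of the [Delta_i] whose coefficients are the
    signed letter counts of the word between [0] and [k].  These counts add up
    to [k].  Since the [Delta_i] are independent over [Q], a relation
    [t_j + t_k = t_m] holds letter by letter, and summing over the letters
    gives [j + k = m].  This yields compatibility and, for [k = 0], the
    injectivity of [k |-> t_k]. *)

(** The case split copies that of [tpoint], so that both unfold in parallel. *)
Definition signed_count {d : nat} (u : int -> 'I_d) (k : int) (i : 'I_d) : int :=
  if 0 < k then (count_mem i (factor u 0 `|k|%N))%:Z
  else if k < 0 then - (count_mem i (factor u k `|k|%N))%:Z
  else 0.

Lemma tpoint_signed_count (R : realType) (d : nat) (Delta : 'I_d -> R)
    (u : int -> 'I_d) (k : int) :
  tpoint Delta u k = \sum_(i < d) (signed_count u k i)%:~R * Delta i.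
Proof.
rewrite /tpoint /signed_count; case: ifP => _ //; case: ifP => _.
  by rewrite -sumrN; apply: eq_bigr => i _; rewrite mulrNz mulNr.
by rewrite big1 // => i _; rewrite mul0r.
Qed.

Lemma sum_count_mem_ord {d : nat} (w : seq 'I_d) :
  (\sum_(i < d) count_mem i w)%N = size w.
Proof.
elim: w => [|x w IHw] /=; first by rewrite big1.
rewrite big_split /= IHw (bigD1 x) //= eqxx big1 // => i /negPf neq_ix.
by rewrite eq_sym neq_ix.
Qed.

Lemma sum_signed_count {d : nat} (u : int -> 'I_d) (k : int) :
  \sum_(i < d) signed_count u k i = k.
Proof.
have sumE a : \sum_(i < d) (count_mem i (factor u a `|k|%N))%:Z = `|k|%N%:Z.
  have := sum_count_mem_ord (factor u a `|k|%N).
  (* Only the right-hand [|k|] becomes a sum of counts; the other one is the length of the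
     factor. *)
  rewrite size_mkseq => {2}<-; rewrite -natz natr_sum.
  by apply: eq_bigr => i _; rewrite natz.
rewrite /signed_count; case: ltrgtP => [k_gt0|k_lt0|<-].
- by rewrite sumE gtz0_abs.
- by rewrite sumrN sumE ltz0_abs // opprK.
- by rewrite big1.
Qed.

Section IndependentLengths.

Context {R : realType} {d : nat} (u : int -> 'I_d) (Delta : 'I_d -> R).
Hypothesis Delta_indep : lin_indep_rat Delta.

Lemma tpoint_add_index (j k m : int) :
  tpoint Delta u j + tpoint Delta u k = tpoint Delta u m -> j + k = m.
Proof.
move/eqP; rewrite -subr_eq0 => /eqP rel.
pose c i := signed_count u j i + signed_count u k i - signed_count u m i.
have c0 i : c i = 0.
  (* Independence speaks of rational coefficients, so the integer [c i] is first cast injectively to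
     [rat]. *)
  apply/eqP; rewrite -(intr_eq0 rat); apply/eqP.
  apply: (Delta_indep (fun i => (c i)%:~R)); rewrite -[RHS]rel.
  rewrite !tpoint_signed_count -big_split -sumrB; apply: eq_bigr => l _ /=.
  by rewrite ratr_int rmorphB rmorphD mulrBl mulrDl.
have sum_c : \sum_(i < d) c i = j + k - m.
  by rewrite sumrB big_split /= !sum_signed_count.
by apply/eqP; rewrite -subr_eq0 -sum_c big1.
Qed.

Lemma tpoint_inj : injective (tpoint Delta u).
Proof.
move=> j k eq_jk; rewrite -[j]addr0; apply: tpoint_add_index.
by rewrite {2}/tpoint ltxx addr0.
Qed.

Definition Sigma_point (k : int) : Sigma Delta u :=
  SigSub (mem_set (ex_intro _ k erefl : Sigma Delta u (tpoint Delta u k))).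

(** Membership in [Sigma] only asserts that an index exists, so one is picked by choice; injectivity
    of [tpoint] makes it the only one. *)
Definition Sigma_index (x : Sigma Delta u) : int := sval (cid (set_valP x)).

Lemma tpoint_Sigma_index (x : Sigma Delta u) :
  tpoint Delta u (Sigma_index x) = val x.
Proof. by rewrite /Sigma_index; case: cid. Qed.

Lemma Sigma_indexK : cancel Sigma_index Sigma_point.
Proof. by move=> x; apply: val_inj; rewrite /= tpoint_Sigma_index. Qed.

Lemma Sigma_pointK : cancel Sigma_point Sigma_index.
Proof. by move=> k; apply: tpoint_inj; rewrite tpoint_Sigma_index. Qed.

(** Applying the rule to the chosen indices determines every value of [op]; this gives uniqueness
    and an explicit formula to compute with. *)
Lemma adds_indicesE (op : Sigma Delta u -> Sigma Delta u -> Sigma Delta u) :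
  adds_indices op ->
  op = fun x y => Sigma_point (Sigma_index x + Sigma_index y).
Proof.
move=> op_add; apply/funext => x; apply/funext => y; apply: val_inj.
by apply: op_add; rewrite tpoint_Sigma_index.
Qed.

(** The rule is well defined: by injectivity, any indices [j], [k] of the two points are the chosen
    ones. *)
Lemma adds_indices_Sigma_point :
  adds_indices (fun x y => Sigma_point (Sigma_index x + Sigma_index y)).
Proof.
move=> j k x y xE yE /=; congr (tpoint _ _ (_ + _)); apply: tpoint_inj.
- by rewrite tpoint_Sigma_index.
- by rewrite tpoint_Sigma_index.
Qed.

End IndependentLengths.

Theorem theorem5p1 (R : realType) (d : nat) (u : int -> 'I_d)
    (Delta : 'I_d -> R)
    (Delta_gt0 : forall i, 0 < Delta i)
    (Delta_indep : lin_indep_rat Delta) :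
  (exists! op : Sigma Delta u -> Sigma Delta u -> Sigma Delta u,
     adds_indices op) /\
  (forall op : Sigma Delta u -> Sigma Delta u -> Sigma Delta u,
     adds_indices op ->
     isomorphic op (fun m n : int => m + n) /\
     compatible_with_addition op).
Proof.
split.
  exists (fun x y =>
    Sigma_point u Delta (Sigma_index u Delta x + Sigma_index u Delta y)).
  split; first exact: adds_indices_Sigma_point.
  by move=> op /adds_indicesE ->.
move=> op /adds_indicesE ->; split.
  (* The isomorphism sends each point to its index. *)
  exists (Sigma_index u Delta); split.
    by exists (Sigma_point u Delta); [exact: Sigma_indexK | exact: Sigma_pointK].
  by move=> x y; rewrite Sigma_pointK.
(* The real sum is some [t_m]; it remains to see that [m] is the sum of the two indices. *)
move=> x y [m sum_xy] /=; rewrite sum_xy; congr (tpoint _ _ _).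
by apply: (tpoint_add_index u Delta Delta_indep); rewrite !tpoint_Sigma_index.
Qed.
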